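(* Let $N\in\mathbb N$ and $\nu>0$. Let $x$ be a point in the interior of $C_N^B=\{x\in\mathbb R^N: x_1\ge x_2\ge\dots\ge x_N\ge 0\}$ and let $y\in\mathbb R^N$. Let $\beta_0\ge1/2$ be such that $\sqrt\beta\, x+y$ lies in the interior of $C_N^B$ for all $\beta\ge\beta_0$. For $\beta\ge\beta_0$ let $(X_{t,k})_{t\ge0}$ be the Bessel process of type $B_N$ with multiplicity $k=(k_1,k_2)=(\nu\beta,\beta)$ starting at $\sqrt\beta\, x+y$, all driven by the same $N$-dimensional Brownian motion $(B_t)_{t\ge0}$. Let $\phi(t,x)$ be the solution of the deterministic ODE of type $B_N$ with parameter $\nu$ and start in $x$ (see context), and let $(W_t)_{t\ge0}$ be the unique solution of the linear SDE $$dW_t^i=dB_t^i+\sum_{j\ne i}\left(\frac{W_t^j-W_t^i}{(\phi_i(t,x)-\phi_j(t,x))^2}-\frac{W_t^j+W_t^i}{(\phi_i(t,x)+\phi_j(t,x))^2}\right)dt-\frac{\nu\, W_t^i}{\phi_i(t,x)^2}\,dt\qquad(i=1,\dots,N)$$ with initial condition $W_0=0$, where $(B_t)_{t\ge0}$ is the same Brownian motion. Then, for every $t>0$, $$\sup_{0\le s\le t,\ \beta\ge\beta_0}\sqrt\beta\cdot\bigl\|X_{s,(\nu\beta,\beta)}-\sqrt\beta\,\phi(s,x)-W_s\bigr\|<\infty\quad\text{almost surely},$$ i.e., $\lim_{\beta\to\infty}\bigl(X_{t,(\nu\beta,\beta)}-\sqrt\beta\,\phi(t,x)\bigr)=W_t$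 locally uniformly in $t$ almost surely, with rate $O(1/\sqrt\beta)$.
   Context: The Bessel process $(X_{t,k})_{t\ge0}$ of type $B_N$ with multiplicity $k=(\nu\beta,\beta)$ is the $C_N^B$-valued continuous (strong) solution of the SDE $$dX_{t,k}^i=dB_t^i+\beta\sum_{j\ne i}\left(\frac{1}{X_{t,k}^i-X_{t,k}^j}+\frac{1}{X_{t,k}^i+X_{t,k}^j}\right)dt+\frac{\nu\beta}{X_{t,k}^i}\,dt\qquad(i=1,\dots,N),$$ where $(B_t)_{t\ge0}=(B_t^1,\dots,B_t^N)_{t\ge0}$ is an $N$-dimensional Brownian motion (the same one for all $\beta$). Convention on versions (since the supremum runs over a continuum of $\beta$): there is an event of probability one on which, for all $\beta\ge\beta_0$ simultaneously, the path $t\mapsto X_{t,k}$ is continuous with values in $C_N^B$, lies in the interior for Lebesgue-almost every time, has locally integrable drift, and satisfies the integrated form of the SDE for all $t\ge0$. For $x$ in the interior of $C_N^B$, $t\mapsto\phi(t,x)=(\phi_1(t,x),\dots,\phi_N(t,x))$, $t\ge0$, denotes the unique solution, which stays in the interior of $C_N^B$, of $$\frac{d}{dt}\phi_i(t,x)=\sum_{j\ne i}\left(\frac{1}{\phi_i(t,x)-\phi_j(t,x)}+\frac{1}{\phi_i(t,x)+\phi_j(t,x)}\right)+\frac{\nu}{\phi_i(t,x)}\quad(i=1,\dots,N),\qquad\phi(0,x)=x.$$ $\|\cdot\|$ is the Euclidean norm on $\mathbb R^N$.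
   Formalization: The initial condition W_0 = 0 is replaced by W_0 = y: with W_0 = 0 and y ≠ 0, at s = 0 the quantity is √β‖y‖, so the supremum is infinite; for y = 0 the statement is unchanged. *)

(* Defs.v *)
From HB Require Import structures.
From mathcomp Require Import all_boot all_order all_algebra.
From mathcomp Require Import all_classical all_reals all_analysis.
Import Order.TTheory GRing.Theory Num.Theory numFieldNormedType.Exports.
Set Implicit Arguments.
Unset Strict Implicit.
Unset Printing Implicit Defensive.
Local Open Scope classical_set_scope.
Local Open Scope ring_scope.

(* Conventions: R^N is 'rV[R]_N; time is the type R and only t >= 0 is ever
   constrained; the coordinates 1, ..., N are indexed by 'I_N. *)

(* The norm that 'rV[R]_N carries in the library is the sup norm. *)
Definition enorm {R : realType} {N : nat} (v : 'rV[R]_N) : R :=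
  Num.sqrt (\sum_(i < N) v 0 i ^+ 2).

Definition weylB {R : realType} {N : nat} : set 'rV[R]_N :=
  [set v | (forall i j : 'I_N, (i <= j)%N -> v 0 j <= v 0 i) /\
           (forall i : 'I_N, 0 <= v 0 i)].

(* k1 belongs to the short roots e_i, k2 to the roots e_i - e_j, e_i + e_j. *)
Definition driftB {R : realType} {N : nat} (k1 k2 : R) (v : 'rV[R]_N) :
    'rV[R]_N :=
  \row_i (k2 * (\sum_(j < N | j != i)
                  ((v 0 i - v 0 j)^-1 + (v 0 i + v 0 j)^-1)) + k1 / v 0 i).

Definition lin_driftB {R : realType} {N : nat} (nu : R) (p w : 'rV[R]_N) :
    'rV[R]_N :=
  \row_i ((\sum_(j < N | j != i)
             ((w 0 j - w 0 i) / (p 0 i - p 0 j) ^+ 2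
              - (w 0 j + w 0 i) / (p 0 i + p 0 j) ^+ 2))
          - nu * w 0 i / p 0 i ^+ 2).

(* The derivative is taken relative to the domain [0, +oo), hence it is
   one-sided at t = 0. *)
Definition ode_solution {R : realType} {N : nat} (b : 'rV[R]_N -> 'rV[R]_N)
    (x : 'rV[R]_N) (phi : R -> 'rV[R]_N) : Prop :=
  phi 0 = x /\
  forall t : R, 0 <= t -> forall i : 'I_N,
    (s - t)^-1 * (phi s 0 i - phi t 0 i) @[s --> within `[0, +oo[ t^']
      --> b (phi t) 0 i.

Section stochastic.
Context {d : measure_display} {T : measurableType d} {R : realType}.
Variable P : probability T R.

Definition mutually_independent {I : finType} (Y : I -> T -> R) : Prop :=
  forall A : I -> set R, (forall i, measurable (A i)) ->
    P (\bigcap_i (Y i @^-1` A i)) = (\prod_(i : I) P (Y i @^-1` A i))%E.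

(* Standard N-dimensional Brownian motion.  The last clause states at once the
   independence of the increments over disjoint intervals and of the
   coordinates.  normal_prob m s is N(m, s^2), and it is degenerate in an
   unwanted way for s = 0, whence s < t. *)
Definition brownian_motion {N : nat} (B : R -> T -> 'rV[R]_N) : Prop :=
  [/\ forall t i, 0 <= t -> measurable_fun setT (fun w => B t w 0 i),
      {ae P, forall w, B 0 w = 0},
      {ae P, forall w, {within `[0, +oo[, continuous (fun t => B t w)}},
      (forall (s t : R) (i : 'I_N) (A : set R), 0 <= s -> s < t ->
         measurable A ->
         P ((fun w => B t w 0 i - B s w 0 i) @^-1` A) =
         normal_prob 0 (Num.sqrt (t - s)) A) &
      forall (t : nat -> R) (n : nat), 0 <= t 0%N ->
        (forall m, t m < t m.+1) ->
        mutually_independent (fun (ki : 'I_n * 'I_N) w =>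
          B (t ki.1.+1) w 0 ki.2 - B (t ki.1) w 0 ki.2)].

(* The natural filtration of B, augmented by all P-negligible sets. *)
Definition augmented_filtration {N : nat} (B : R -> T -> 'rV[R]_N) (t : R) :
    set (set T) :=
  <<s [set E | exists (s : R) (i : 'I_N) (A : set R),
        [/\ 0 <= s <= t, measurable A & E = (fun w => B s w 0 i) @^-1` A]]
      `|` P.-negligible >>.

Definition adapted {N : nat} (B Z : R -> T -> 'rV[R]_N) : Prop :=
  forall (t : R) (i : 'I_N) (A : set R), 0 <= t -> measurable A ->
    augmented_filtration B t ((fun w => Z t w 0 i) @^-1` A).

(* Integrated form of dz = db + f(t, z) dt, z(0) = z0, for fixed continuous
   paths; the drift has to be locally integrable. *)
Definition integral_solution {N : nat} (f : R -> 'rV[R]_N -> 'rV[R]_N)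
    (z0 : 'rV[R]_N) (b z : R -> 'rV[R]_N) : Prop :=
  {within `[0, +oo[, continuous z} /\
  forall (t : R) (i : 'I_N), 0 <= t ->
    lebesgue_measure.-integrable `[0, t] (fun s => (f s (z s) 0 i)%:E) /\
    z t 0 i = z0 0 i + b t 0 i
              + \int[lebesgue_measure]_(s in `[0, t]) f s (z s) 0 i.

(* Strong solution of dZ = dB + f(t, Z) dt, Z(0) = z0. *)
Definition strong_solution {N : nat} (f : R -> 'rV[R]_N -> 'rV[R]_N)
    (z0 : 'rV[R]_N) (B Z : R -> T -> 'rV[R]_N) : Prop :=
  adapted B Z /\
  {ae P, forall w, integral_solution f z0 (B ^~ w) (Z ^~ w)}.

(* A path of the Bessel process of type B_N.  On the boundary of the chamber
   driftB takes junk values, as 0^-1 = 0, but the path spends almost no time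
   there. *)
Definition bessel_path {N : nat} (k1 k2 : R) (z0 : 'rV[R]_N)
    (b z : R -> 'rV[R]_N) : Prop :=
  [/\ forall t : R, 0 <= t -> weylB (z t),
      {ae lebesgue_measure, forall t, 0 <= t -> (@weylB R N)° (z t)} &
      integral_solution (fun=> driftB k1 k2) z0 b z].

(* Bessel processes X beta of multiplicity (nu * beta, beta), beta >= beta0,
   with starting points z0 beta and driven by the same B; the exceptional event
   does not depend on beta. *)
Definition bessel_family {N : nat} (nu beta0 : R) (z0 : R -> 'rV[R]_N)
    (B : R -> T -> 'rV[R]_N) (X : R -> R -> T -> 'rV[R]_N) : Prop :=
  (forall beta, beta0 <= beta -> adapted B (X beta)) /\
  {ae P, forall w, forall beta, beta0 <= beta ->
    bessel_path (nu * beta) beta (z0 beta) (B ^~ w) (fun t => X beta t w)}.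

End stochastic.

(* Main.v *)
Require Import Defs.
From HB Require Import structures.
From mathcomp Require Import all_boot all_order all_algebra.
From mathcomp Require Import all_classical all_reals all_analysis.
From mathcomp Require Import ring lra.
Import Order.TTheory GRing.Theory Num.Theory numFieldNormedType.Exports.
Set Implicit Arguments.
Unset Strict Implicit.
Unset Printing Implicit Defensive.
Local Open Scope classical_set_scope.
Local Open Scope ring_scope.

(* Pathwise, B cancels in Z = X - a phi - W, so Z is absolutely continuous.
   With F = driftB nu 1, which is homogeneous of degree -1, its derivative is
     (beta F(X) - beta F(a phi + W))
       + (beta F(a phi + W) - a F(phi) - DF(phi) W).
   F is monotone decreasing on the open chamber (it is the gradient of a concave
   function), so the first difference contributes nothing positive to
   d|Z|^2/dt, and |Z(s)| <= |Z(0)| + O(s c) as soon as the second one is at most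
   c.  For a = sqrt beta large enough that a phi + W stays in the chamber up to
   time t, Z(0) = 0 and a root-by-root Taylor expansion gives
   c = O(1 / sqrt beta).  The remaining beta form a bounded set, on which a fixed
   large a gives a uniform bound. *)

(** * Monotonicity from a local condition *)

(** Real induction: the local condition at the supremum of [E] carries [h s <= h a] past that
    supremum, unless [b] is reached first. The condition compares any two points near [c], on either
    side, so no continuity of [h] is required. *)
Lemma locally_nonincreasing_le (R : realType) (h : R -> R) (a b : R) :
  a <= b ->
  (forall c, a <= c <= b -> exists2 e, 0 < e & forall r s,
     a <= r -> r <= s -> s <= b -> c - e < r -> s < c + e -> h s <= h r) ->
  h b <= h a.
Proof.
move=> ab loc.
pose E := [set s | a <= s <= b /\ h s <= h a].
have Ea : E a by split; rewrite ?lexx ?ab.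
have bE : ubound E b by move=> s [/andP[_ ->]].
have supE : has_sup E by split; [exists a | exists b].
have aS : a <= sup E by apply: ub_le_sup => //; exists b.
have Sb : sup E <= b by apply: ge_sup => //; exists a.
have [e e0 he] := loc (sup E) ltac:(by rewrite aS Sb).
have [s [/andP[as_ sb] hs] sgt] := sup_adherent e0 supE.
have sS : s <= sup E by apply: ub_le_sup => //; [exists b | split; rewrite ?as_ ?sb].
have [blt|ble] := ltP b (sup E + e).
  by apply: le_trans (he s b as_ sb _ _ _) hs.
pose c := sup E + e / 2.
have cE : E c.
  split; first by apply/andP; split; rewrite /c; lra.
  by apply: le_trans (he s c as_ _ _ _ _) hs; rewrite /c; lra.
have : c <= sup E by apply: ub_le_sup => //; exists b.
by rewrite /c; lra.
Qed.

(** * Almost everywhere bounds of integrals *)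

Lemma ae_Rintegral_ge0 (d : measure_display) (T : measurableType d)
    (R : realType) (mu : {measure set T -> \bar R}) (D : set T) (f : T -> R) :
  measurable D -> mu.-integrable D (EFin \o f) ->
  {ae mu, forall x, D x -> 0 <= f x} -> 0 <= \int[mu]_(x in D) f x.
Proof.
move=> mD intf f0.
have mf := measurable_int mu intf.
(* On [D], [f] agrees almost everywhere with its absolute value, whose integral is nonnegative. *)
rewrite /Rintegral (_ : (\int[mu]_(x in D) _)%E =
  \int[mu]_(x in D) `|f x|%:E)%E; first by rewrite fine_ge0// integral_ge0.
apply: ae_eq_integral => //; first exact: measurable_int (integrable_norm intf).
by apply: filterS f0 => x fx Dx; rewrite ger0_norm// fx.
Qed.

(* The hints of the library for filters of almost everywhere properties fail on
   the type that [lebesgue_measure] lives on. *)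
#[local] Instance ae_lebesgue_filter (R : realType) :
  Filter (nbhs (almost_everywhere (@lebesgue_measure R))) :=
  ae_filter_ringOfSetsType (@lebesgue_measure R).

Lemma ae_Rintegral_le_cst (R : realType) (r s K : R) (f : R -> R) :
  r <= s -> lebesgue_measure.-integrable `]r, s] (EFin \o f) ->
  {ae lebesgue_measure, forall x, r < x <= s -> f x <= K} ->
  \int[lebesgue_measure]_(x in `]r, s]) f x <= K * (s - r).
Proof.
move=> rs intf fK.
have intK : lebesgue_measure.-integrable `]r, s] (EFin \o (cst K : R -> R)).
  suff /integrableS : lebesgue_measure.-integrable `[r, s]
      (EFin \o (cst K : R -> R)).
    by apply => //; exact: subset_itv_oc_cc.
  apply: continuous_compact_integrable; first exact: segment_compact.
  by apply: continuous_subspaceT => ?; exact: cvg_cst.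
have len : fine (lebesgue_measure (`]r, s] : set R)) = s - r.
  rewrite lebesgue_measure_itv/= lte_fin.
  by case: ltgtP rs => //= -> _; rewrite subrr.
rewrite -subr_ge0 -[X in K * X]len -Rintegral_cst// -RintegralB//.
apply: ae_Rintegral_ge0 => //; first exact: (integrableB _ intK intf).
by apply: filterS fK => x fx; rewrite /= in_itv/= subr_ge0.
Qed.

Lemma EFin_integrable_sum (d : measure_display) (T : measurableType d)
    (R : realType) (mu : {measure set T -> \bar R}) (D : set T) (I : Type)
    (r : seq I) (P : pred I) (f : I -> T -> R) :
  measurable D -> (forall i, mu.-integrable D (EFin \o f i)) ->
  mu.-integrable D (EFin \o (fun x => \sum_(i <- r | P i) f i x)).
Proof.
move=> mD intf; apply: eq_integrable (integrable_sum mD r (fun i _ => intf i)).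
by [].
by move=> x _ /=; rewrite sumEFin.
Qed.

Lemma Rintegral_sum (d : measure_display) (T : measurableType d)
    (R : realType) (mu : {measure set T -> \bar R}) (D : set T) (I : Type)
    (r : seq I) (P : pred I) (f : I -> T -> R) :
  measurable D -> (forall i, mu.-integrable D (EFin \o f i)) ->
  \int[mu]_(x in D) (\sum_(i <- r | P i) f i x) =
  \sum_(i <- r | P i) \int[mu]_(x in D) f i x.
Proof.
move=> mD intf; elim: r => [|i r ih].
  by rewrite big_nil; under eq_Rintegral do rewrite big_nil;
     rewrite Rintegral_cst// mul0r.
rewrite big_cons -ih; case: ifP => Pi.
  by under eq_Rintegral do rewrite big_cons Pi;
     rewrite RintegralD//; exact: EFin_integrable_sum.
by under eq_Rintegral do rewrite big_cons Pi.
Qed.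

Lemma cvg_sum (R : realType) (T I : Type) (F : set_system T) (r : seq I)
    (P : pred I) (f : I -> T -> R) (l : I -> R) :
  Filter F -> (forall i, P i -> f i x @[x --> F] --> l i) ->
  \sum_(i <- r | P i) f i x @[x --> F] --> \sum_(i <- r | P i) l i.
Proof. by move=> FF fl; apply: cvg_big => //; exact: add_continuous. Qed.

Lemma within_continuous_fam_dist (R : realType) (I : finType) (D : set R)
    (f : I -> R -> R) (c e : R) :
  (forall i, {within D, continuous (f i)}) -> D c -> 0 < e ->
  exists2 d, 0 < d &
    forall s, D s -> `|s - c| < d -> forall i, `|f i s - f i c| < e.
Proof.
move=> cf Dc e0.
have : \forall s \near within D (nbhs c), forall i, `|f i s - f i c| < e.
  apply: filter_forall => i.
  have /subspace_continuousP/(_ c Dc)/cvgrPdist_lt/(_ e e0) := cf i.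
  by apply: filterS => s; rewrite distrC.
rewrite nearE /within /= => /nbhs_ballP[d d0 hd].
exists d => // s Ds sc; apply: hd => //.
by rewrite /ball /= distrC.
Qed.

(** * The energy estimate *)

Section energy.
Context {R : realType}.
Notation mu := (@lebesgue_measure R).
Variables (N : nat) (t : R) (z0 : 'I_N -> R) (g z : 'I_N -> R -> R).
Hypothesis t_ge0 : 0 <= t.
Hypothesis g_int : forall i, mu.-integrable `[0, t] (EFin \o g i).
Hypothesis zE : forall i s, 0 <= s <= t ->
  z i s = z0 i + \int[mu]_(u in `[0, s]) g i u.

Lemma primitive_continuous i : {within `[0, t], continuous (z i)}.
Proof.
have := parameterized_integral_continuous t_ge0 (g_int i).
move=> /subspace_continuousP ct; apply/subspace_continuousP => c cab.
rewrite /from_subspace zE; last by move: cab; rewrite /= in_itv.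
have : (fun s => z0 i + parameterized_integral mu 0 s (g i)) u
  @[u --> within `[0, t]%classic (nbhs c)] -->
  z0 i + parameterized_integral mu 0 c (g i).
  by apply: cvgD; [exact: cvg_cst | exact: ct].
apply: cvg_trans; apply: near_eq_cvg; rewrite near_withinE; near=> s => /= st.
by rewrite /from_subspace zE//; move: st; rewrite in_itv.
Unshelve. all: by end_near. Qed.

Lemma primitive_diff i r s : 0 <= r -> r <= s -> s <= t ->
  z i s - z i r = \int[mu]_(u in `]r, s]) g i u.
Proof.
move=> r0 rs st; rewrite !zE ?r0 ?st ?(le_trans r0 rs) ?(le_trans rs st)//.
rewrite opprD addrACA subrr add0r Rintegral_itvB//= ?bnd_simp//.
by apply: integrableS (g_int i) => //; apply: subset_itvl; rewrite bnd_simp.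
Qed.

Lemma integrable_oc i r s : 0 <= r -> s <= t ->
  mu.-integrable `]r, s] (EFin \o g i).
Proof.
move=> r0 st; apply: integrableS (g_int i) => //.
by apply: subset_itv; rewrite bnd_simp.
Qed.

(* By convexity |z s|^2 - |z r|^2 <= 2 z s . (z s - z r), the integral of
   2 z s . g over ]r, s]; replacing z s by z u in it costs at most the
   oscillation eta of z times the integral of sum_i |g i|. *)
Lemma energy_step K eta r s : 0 <= r -> r <= s -> s <= t -> 0 <= eta ->
  {ae mu, forall u, 0 <= u <= t -> \sum_i z i u * g i u <= K} ->
  (forall u i, r < u <= s -> `|z i s - z i u| <= eta) ->
  \sum_i z i s ^+ 2 - \sum_i z i r ^+ 2 <=
  2 * (K * (s - r) + eta * \sum_i \int[mu]_(u in `]r, s]) `|g i u|).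
Proof.
move=> r0 rs st eta0 zgK osc.
have mD : measurable (`]r, s]%classic : set (measurableTypeR R)) by [].
have intn i : mu.-integrable `]r, s] (EFin \o (fun u => `|g i u|)).
  exact: integrable_norm (integrable_oc i r0 st).
have intz i : mu.-integrable `]r, s] (EFin \o (fun u => z i s * g i u)).
  exact: integrableZl (integrable_oc i r0 st).
have intn' i : mu.-integrable `]r, s] (EFin \o (fun u => eta * `|g i u|)).
  exact: integrableZl (intn i).
have := @ae_Rintegral_le_cst R r s K
  (fun u => \sum_i z i s * g i u - \sum_i eta * `|g i u|) rs _ _.
rewrite RintegralB//; [|exact: EFin_integrable_sum..].
rewrite !Rintegral_sum//.
under eq_bigr do rewrite RintegralZl ?integrable_oc// -primitive_diff//.
under [X in _ - X]eq_bigr do rewrite RintegralZl ?intn//.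
rewrite -mulr_sumr => H.
have {H} : \sum_i z i s * (z i s - z i r) <=
    K * (s - r) + eta * \sum_i \int[mu]_(u in `]r, s]) `|g i u|.
  rewrite -lerBlDr; apply: H.
    exact: (integrableB mD (EFin_integrable_sum _ _ mD intz) (EFin_integrable_sum _ _ mD intn')).
  apply: filterS zgK => u zgK /andP[ru us].
  apply: le_trans (zgK _); last by apply/andP; split; lra.
  rewrite lerBlDr -big_split /=; apply: ler_sum => i _.
  rewrite -lerBlDl -mulrBl; apply: le_trans (ler_norm _) _.
  by rewrite normrM ler_wpM2r// osc// ru.
move=> /(ler_wpM2l (ler0n R 2)); apply: le_trans.
rewrite -sumrB mulr_sumr; apply: ler_sum => i _.
by have := sqr_ge0 (z i s - z i r); lra.
Qed.

(** Integrated form of d|z|^2/dt = 2 z . g <= 2 K. As [g] is merely integrable, the chain rule is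
    replaced by [energy_step] on short intervals, where continuity makes the oscillation of [z] at
    most [eta]. The errors add up to [2 * eta * G t], which is arbitrarily small. *)
Lemma energy_le K :
  {ae mu, forall u, 0 <= u <= t -> \sum_i z i u * g i u <= K} ->
  \sum_i z i t ^+ 2 <= \sum_i z0 i ^+ 2 + 2 * K * t.
Proof.
move=> zgK.
pose G s := \sum_i \int[mu]_(u in `[0, s]) `|g i u|.
have intn i : mu.-integrable `[0, t] (EFin \o (fun u => `|g i u|)).
  exact: integrable_norm (g_int i).
have Gdiff r s : 0 <= r -> r <= s -> s <= t ->
    G s - G r = \sum_i \int[mu]_(u in `]r, s]) `|g i u|.
  move=> r0 rs st; rewrite -sumrB; apply: eq_bigr => i _.
  rewrite Rintegral_itvB//= ?bnd_simp//.
  by apply: integrableS (intn i) => //; apply: subset_itvl; rewrite bnd_simp.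
have z00 i : z i 0 = z0 i.
  by rewrite zE ?lexx ?t_ge0// set_itv1 Rintegral_set1 addr0.
have G0 : G 0 = 0.
  by rewrite /G big1// => i _; rewrite set_itv1 Rintegral_set1.
have Gt0 : 0 <= G t.
  by apply: sumr_ge0 => i _; apply: Rintegral_ge0.
apply/ler_addgt0Pr => e e0.
(* Makes [2 * eta * G t] at most [e]; the [+ 1] covers [G t = 0]. *)
pose eta := e / (2 * (G t + 1)).
have eta0 : 0 < eta by rewrite divr_gt0//; lra.
(* With both error terms subtracted, [energy_step] says exactly that [H] is locally
   nonincreasing. *)
pose H s := \sum_i z i s ^+ 2 - 2 * K * s - 2 * eta * G s.
have : H t <= H 0.
  apply: locally_nonincreasing_le => // c ct.
  have eta20 : 0 < eta / 2 by lra.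
  have cI : `[0, t]%classic c by rewrite /= in_itv.
  have [d d0 hd] := within_continuous_fam_dist primitive_continuous cI eta20.
  exists d => // r s r0 rs st cr sc; rewrite /H.
  have := @energy_step K eta r s r0 rs st (ltW eta0) zgK _.
  rewrite -Gdiff// => step.
  suff : forall u i, r < u <= s -> `|z i s - z i u| <= eta by move/step; lra.
  move=> u i /andP[ru us].
  have hs : `|z i s - z i c| < eta / 2.
    by apply: hd; [rewrite /= in_itv /=; lra | rewrite ltr_norml; lra].
  have hu : `|z i u - z i c| < eta / 2.
    by apply: hd; [rewrite /= in_itv /=; lra | rewrite ltr_norml; lra].
  rewrite ler_norml; move: hs hu; rewrite !ltr_norml; lra.
rewrite /H G0 !mulr0 !subr0; under [X in _ <= X]eq_bigr do rewrite z00.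
have -> : 2 * eta * G t = e * (G t / (G t + 1)).
  by rewrite /eta; field; rewrite gt_eqF//; lra.
have : e * (G t / (G t + 1)) <= e.
  by apply: ler_piMr; [exact: ltW | rewrite ler_pdivrMr; lra].
lra.
Qed.

End energy.

Lemma sum_norm_le_sqrt (R : realType) N (v : 'I_N -> R) :
  \sum_i `|v i| <= N%:R * Num.sqrt (\sum_i v i ^+ 2).
Proof.
apply: le_trans (_ : \sum_(i < N) Num.sqrt (\sum_i v i ^+ 2) <= _).
  apply: ler_sum => i _; rewrite -sqrtr_sqr ler_sqrt//.
    by rewrite (bigD1 i)//= lerDl sumr_ge0// => j _; exact: sqr_ge0.
  by apply: sumr_ge0 => j _; exact: sqr_ge0.
by rewrite sumr_const card_ord mulr_natl.
Qed.

(* At a maximum point M = |z| on [0, t], energy_le gives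
   M^2 <= |z0|^2 + 2 C N M t. *)
Lemma energy_bound (R : realType) (N : nat) (t C : R) (z0 : 'I_N -> R)
    (g z : 'I_N -> R -> R) :
  0 <= t -> 0 <= C ->
  (forall i, lebesgue_measure.-integrable `[0, t] (EFin \o g i)) ->
  (forall i s, 0 <= s <= t ->
    z i s = z0 i + \int[lebesgue_measure]_(u in `[0, s]) g i u) ->
  {ae lebesgue_measure, forall u, 0 <= u <= t ->
    \sum_i z i u * g i u <= C * \sum_i `|z i u|} ->
  forall s, 0 <= s <= t -> Num.sqrt (\sum_i z i s ^+ 2) <=
    Num.sqrt (\sum_i z0 i ^+ 2) + 2 * C * N%:R * t.
Proof.
move=> t0 C0 gint zE zgC.
pose n s := Num.sqrt (\sum_i z i s ^+ 2).
have cn : {within `[0, t], continuous n}.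
  apply/subspace_continuousP => c ct.
  rewrite /from_subspace /n; apply: continuous_cvg; first exact: sqrt_continuous.
  apply: cvg_sum => i _ /=.
  have /subspace_continuousP/(_ c ct) cz := primitive_continuous t0 gint zE (i := i).
  by rewrite expr2; under eq_fun do rewrite expr2; exact: cvgM.
have [m] := EVT_max t0 cn; rewrite in_itv /= => m0t nmax.
suff nm : n m <= Num.sqrt (\sum_i z0 i ^+ 2) + 2 * C * N%:R * t.
  by move=> s st; apply: le_trans nm; apply: nmax; rewrite in_itv.
have n0 s : 0 <= n s := sqrtr_ge0 _.
have /andP[m0 mt] := m0t.
have Ngint i : lebesgue_measure.-integrable `[0, m] (EFin \o g i).
  by apply: integrableS (gint i) => //; apply: subset_itvl; rewrite bnd_simp.
have zEm i s : 0 <= s <= m ->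
    z i s = z0 i + \int[lebesgue_measure]_(u in `[0, s]) g i u.
  by move=> /andP[s0 sm]; apply: zE; rewrite s0 (le_trans sm).
have := energy_le (K := C * (N%:R * n m)) m0 Ngint zEm _.
set S0 := \sum_i z0 i ^+ 2 => H.
have S00 : 0 <= S0 by apply: sumr_ge0 => i _; exact: sqr_ge0.
have {H} : n m ^+ 2 <= Num.sqrt S0 ^+ 2 + 2 * (C * (N%:R * n m)) * t.
  rewrite !sqr_sqrtr//; last by apply: sumr_ge0 => i _; exact: sqr_ge0.
  apply: le_trans (H _) _; last first.
    by rewrite lerD2l ler_wpM2l// !mulr_ge0.
  apply: filterS zgC => u zgC /andP[u0 um].
  have ut : 0 <= u <= t by rewrite u0 (le_trans um).
  apply: le_trans (zgC ut) _; rewrite ler_wpM2l//.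
  apply: le_trans (sum_norm_le_sqrt _) _; rewrite ler_wpM2l//.
  by apply: nmax; rewrite in_itv.
set r := Num.sqrt S0; have r0 : 0 <= r := sqrtr_ge0 _.
set D := 2 * C * N%:R * t; have D0 : 0 <= D by rewrite !mulr_ge0.
rewrite (_ : 2 * (C * (N%:R * n m)) * t = D * n m); last by rewrite /D; ring.
(* The inequality q^2 <= r^2 + D q, for q = [n m], forces q <= r + D: otherwise q^2 > (r + D) q >=
   r^2 + D q. *)
move=> H; rewrite leNgt; apply/negP => lt.
have : (r + D) * n m < n m ^+ 2.
  by rewrite expr2 ltr_pM2r// (le_lt_trans _ lt)// addr_ge0.
have : r ^+ 2 <= r * n m.
  by rewrite expr2 ler_wpM2l// (le_trans _ (ltW lt))// lerDl.
lra.
Qed.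

(** * The drift of type B *)

Definition open_chamber {R : realType} {N : nat} (v : 'rV[R]_N) : Prop :=
  (forall i j : 'I_N, (i < j)%N -> v 0 j < v 0 i) /\
  (forall i : 'I_N, 0 < v 0 i).

(** Lowering a single coordinate of [v] slightly stays in [weylB]; the weak inequalities of the
    shifted point are strict ones for [v]. *)
Lemma weylB_interior (R : realType) (N : nat) (v : 'rV[R]_N) :
  (@weylB R N)° v -> open_chamber v.
Proof.
move=> /nbhs_ballP[e /= e0 hv].
have shift i : weylB (v - (e / 2) *: delta_mx 0 i).
  apply: hv; split => // a b; rewrite !mxE /ball/= opprB subrKC.
  by case: (_ && _); rewrite ?mulr0 ?normr0// mulr1 gtr0_norm; lra.
split=> [i j ij|i].
- have [/(_ i j (ltnW ij)) + _] := shift i.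
  have /negbTE ji : j != i by rewrite -val_eqE /= gtn_eqF.
  by rewrite !mxE !eqxx ji /=; lra.
- have [_ /(_ i)] := shift i.
  by rewrite !mxE !eqxx/=; lra.
Qed.

Lemma open_chamber_same_sign (R : realType) (N : nat) (u v : 'rV[R]_N)
    (i j : 'I_N) : open_chamber u -> open_chamber v -> i != j ->
  0 < (u 0 i - u 0 j) * (v 0 i - v 0 j).
Proof.
move=> [u_decr _] [v_decr _]; rewrite -val_eqE /= neq_ltn => /orP[ij|ji].
  by rewrite mulr_gt0// subr_gt0; [exact: u_decr | exact: v_decr].
by rewrite nmulr_rgt0 subr_lt0 ?u_decr ?v_decr.
Qed.

(** A common sign suffices, not positivity: the difference of coordinates [i] and [j] is negative on
    the chamber when [j < i]. *)
Lemma inv_decreasing (R : realType) (a b : R) : 0 < a * b ->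
  (a - b) * (a^-1 - b^-1) <= 0.
Proof.
move=> ab0; have /andP[a0 b0] : (a != 0) && (b != 0).
  by rewrite -negb_or -mulf_eq0 gt_eqF.
rewrite (_ : _ * _ = - ((a - b) ^+ 2 / (a * b))); last by field; rewrite a0 b0.
by rewrite oppr_le0 divr_ge0 ?sqr_ge0 // ltW.
Qed.

(** Symmetrization: twice the sum groups (i, j) with (j, i). In the monotonicity of the drift only
    these paired contributions have a sign. *)
Lemma sum_offdiag_le0 (R : realType) (N : nat) (f : 'I_N -> 'I_N -> R) :
  (forall i j, i != j -> f i j + f j i <= 0) ->
  \sum_i \sum_(j | j != i) f i j <= 0.
Proof.
move=> f0; set S := (X in X <= 0).
have : S + S <= 0.
  rewrite {2}/S (exchange_big_dep predT)//= -big_split/=.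
  apply: sumr_le0 => i _; under [X in _ + X]eq_bigl do rewrite eq_sym.
  by rewrite -big_split/= sumr_le0// => j ji; rewrite f0// eq_sym.
lra.
Qed.

(** Each root contributes a term of the form (a - b)(1/a - 1/b), where a and b are its values at [u]
    and [v]. For the roots e_i - e_j and e_i + e_j this form appears after adding the (i, j) and (j,
    i) terms. *)
Lemma driftB_monotone (R : realType) (N : nat) (k1 k2 : R) (u v : 'rV[R]_N) :
  0 <= k1 -> 0 <= k2 -> open_chamber u -> open_chamber v ->
  \sum_i (u 0 i - v 0 i) * (driftB k1 k2 u 0 i - driftB k1 k2 v 0 i) <= 0.
Proof.
move=> k10 k20 cu cv.
pose f i j := (u 0 i - v 0 i) *
  ((u 0 i - u 0 j)^-1 - (v 0 i - v 0 j)^-1 +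
   ((u 0 i + u 0 j)^-1 - (v 0 i + v 0 j)^-1)).
pose h i := (u 0 i - v 0 i) * ((u 0 i)^-1 - (v 0 i)^-1).
rewrite (_ : \sum_i _ = k2 * (\sum_i \sum_(j | j != i) f i j) +
    k1 * \sum_i h i); last first.
  rewrite !mulr_sumr -big_split/=; apply: eq_bigr => i _; rewrite !mxE.
  rewrite -mulr_sumr /h.
  under [X in _ = _ * (_ * X) + _]eq_bigr do rewrite addrACA -opprD.
  by rewrite sumrB; ring.
have pu i : 0 < u 0 i by case: cu.
have pv i : 0 < v 0 i by case: cv.
rewrite -[leRHS]addr0; apply: lerD; apply: mulr_ge0_le0 => //.
  apply: sum_offdiag_le0 => i j ij; rewrite /f.
  have D := inv_decreasing (open_chamber_same_sign cu cv ij).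
  have S := @inv_decreasing R (u 0 i + u 0 j) (v 0 i + v 0 j)
    (mulr_gt0 (addr_gt0 (pu i) (pu j)) (addr_gt0 (pv i) (pv j))).
  rewrite (addrC (u 0 j) (u 0 i)) (addrC (v 0 j) (v 0 i)).
  rewrite -[u 0 j - u 0 i]opprB -[v 0 j - v 0 i]opprB !invrN.
  by move: D S; lra.
by apply: sumr_le0 => i _; apply: inv_decreasing; rewrite mulr_gt0.
Qed.

(* The remainder in direction alpha of the linearization at p of
   q |-> b F(a p + q), with u = alpha . p and v = alpha . q. *)
Definition root_remainder {R : realType} (b a u v : R) : R :=
  b / (a * u + v) - a / u + v / u ^+ 2.

(** [lin_driftB nu p q] is the derivative of [driftB nu 1] at [p] in direction [q], as 1/u varies by
    -v/u^2 along v. The remainder therefore splits over the roots. *)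
Lemma driftB_linearization (R : realType) (N : nat) (nu b a : R)
    (p q : 'rV[R]_N) (i : 'I_N) :
  driftB (nu * b) b (a *: p + q) 0 i - a * driftB nu 1 p 0 i
    - lin_driftB nu p q 0 i =
  \sum_(j | j != i) (root_remainder b a (p 0 i - p 0 j) (q 0 i - q 0 j) +
     root_remainder b a (p 0 i + p 0 j) (q 0 i + q 0 j))
  + nu * root_remainder b a (p 0 i) (q 0 i).
Proof.
have E : \sum_(j | j != i)
    (root_remainder b a (p 0 i - p 0 j) (q 0 i - q 0 j) +
     root_remainder b a (p 0 i + p 0 j) (q 0 i + q 0 j)) =
  b * (\sum_(j < N | j != i) (((a *: p + q) 0 i - (a *: p + q) 0 j)^-1 +
                          ((a *: p + q) 0 i + (a *: p + q) 0 j)^-1))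
  - a * (\sum_(j < N | j != i) ((p 0 i - p 0 j)^-1 + (p 0 i + p 0 j)^-1))
  - (\sum_(j < N | j != i) ((q 0 j - q 0 i) / (p 0 i - p 0 j) ^+ 2
              - (q 0 j + q 0 i) / (p 0 i + p 0 j) ^+ 2)).
  rewrite !mulr_sumr -!sumrB; apply: eq_bigr => j _; rewrite !mxE.
  rewrite (_ : a * p 0 i + q 0 i - (a * p 0 j + q 0 j) =
     a * (p 0 i - p 0 j) + (q 0 i - q 0 j)); last by ring.
  rewrite (_ : a * p 0 i + q 0 i + (a * p 0 j + q 0 j) =
     a * (p 0 i + p 0 j) + (q 0 i + q 0 j)); last by ring.
  by rewrite /root_remainder; ring.
by rewrite E /driftB /lin_driftB /root_remainder !mxE; ring.
Qed.

(** * Bounds for the remainder of a single root *)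

Section root_remainder_bounds.
Context {R : realType}.
Variables (m M a u v : R).
Hypotheses (m0 : 0 < m) (um : m <= `|u|) (vM : `|v| <= M) (a1 : 1 <= a)
  (aM : 2 * M <= a * m).

Let a0 : 0 <= a. Proof. exact: le_trans a1. Qed.

Let M0 : 0 <= M. Proof. exact: le_trans vM. Qed.

(** By [aM] the perturbation [v] is at most half of [a * m], so the shifted root keeps at least half
    that size. *)
Lemma shifted_root_ge : a * m / 2 <= `|a * u + v|.
Proof.
have := lerB_normD (a * u) v; rewrite normrM (ger0_norm a0).
have : a * m <= a * `|u| by rewrite ler_wpM2l.
by move: vM aM; lra.
Qed.

Let am0 : 0 < a * m / 2. Proof. by rewrite divr_gt0 ?mulr_gt0// (lt_le_trans ltr01). Qed.

Let inv_shifted : `|(a * u + v)^-1| <= (a * m / 2)^-1.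
Proof.
rewrite normfV lef_pV2 ?posrE ?shifted_root_ge//.
exact: lt_le_trans shifted_root_ge.
Qed.

Let inv_u : `|u^-1| <= m^-1.
Proof. by rewrite normfV lef_pV2 ?posrE//; exact: lt_le_trans um. Qed.

Let inv_u2 : `|u^-1| ^+ 2 <= m^-1 ^+ 2.
Proof.
by apply: lerXn2r => //; rewrite nnegrE invr_ge0 ltW.
Qed.

(** Crude termwise bound without cancellation, meant for a fixed [a] and bounded [b]. *)
Lemma root_remainder_le b : 0 <= b <= a ^+ 2 ->
  `|root_remainder b a u v| <= 3 * a / m + M / m ^+ 2.
Proof.
move=> /andP[b0 ba]; have a0' : 0 < a := lt_le_trans ltr01 a1.
rewrite (_ : 3 * a / m = a ^+ 2 * (a * m / 2)^-1 + a * m^-1); last first.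
  by field; rewrite !gt_eqF.
apply: le_trans (ler_normD _ _) _; apply: lerD.
  apply: le_trans (ler_normB _ _) _; apply: lerD; rewrite normrM ger0_norm//.
  - by rewrite ler_pM.
  - by rewrite ler_wpM2l.
by rewrite normrM -!exprVn normrX ler_pM.
Qed.

(** For b = a^2 the terms of order zero and one cancel and leave exactly v^2 / (u^2 (a u + v)),
    which is O(1/a). This is the source of the rate. *)
Lemma root_remainder_sqr_le :
  `|root_remainder (a ^+ 2) a u v| <= 2 * M ^+ 2 / m ^+ 3 / a.
Proof.
have u0 : u != 0 by rewrite -normr_gt0; exact: lt_le_trans um.
have au0 : a * u + v != 0.
  by rewrite -normr_gt0; exact: lt_le_trans shifted_root_ge.
have a0' : 0 < a := lt_le_trans ltr01 a1.
rewrite (_ : root_remainder _ _ _ _ = v ^+ 2 * (u^-1 ^+ 2 * (a * u + v)^-1));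
  last by rewrite /root_remainder; field; rewrite u0 au0.
rewrite (_ : _ / a = M ^+ 2 * (m^-1 ^+ 2 * (a * m / 2)^-1)); last first.
  by field; rewrite !gt_eqF.
rewrite normrM normrX ler_pM ?exprn_ge0//.
  by apply: lerXn2r; rewrite ?nnegrE.
by rewrite normrM normrX ler_pM ?exprn_ge0.
Qed.

End root_remainder_bounds.

(** Coordinate [i] sees at most [2 * N] long roots and one short root of weight [nu]. *)
Lemma driftB_linearization_le (R : realType) (N : nat) (nu b a c : R)
    (p q : 'rV[R]_N) (i : 'I_N) : 0 <= nu -> 0 <= c ->
  (forall j, j != i ->
     `|root_remainder b a (p 0 i - p 0 j) (q 0 i - q 0 j)| <= c) ->
  (forall j, `|root_remainder b a (p 0 i + p 0 j) (q 0 i + q 0 j)| <= c) ->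
  `|root_remainder b a (p 0 i) (q 0 i)| <= c ->
  `|driftB (nu * b) b (a *: p + q) 0 i - a * driftB nu 1 p 0 i
     - lin_driftB nu p q 0 i| <= (2 * N%:R + nu) * c.
Proof.
move=> nu0 c0 cD cS cR; rewrite driftB_linearization.
apply: le_trans (ler_normD _ _) _; rewrite mulrDl; apply: lerD; last first.
  by rewrite normrM ger0_norm// ler_wpM2l.
apply: le_trans (ler_norm_sum _ _ _) _.
apply: (@le_trans _ _ (\sum_(j < N) (c + c))).
  rewrite [leRHS](bigID (fun j => j != i))/= -[leLHS]addr0; apply: lerD.
    apply: ler_sum => j ji; apply: le_trans (ler_normD _ _) _.
    by apply: lerD; [exact: cD | exact: cS].
  by apply: sumr_ge0 => j _; exact: addr_ge0.
by rewrite sumr_const card_ord -[X in X <= _]mulr_natl; lra.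
Qed.

(** * The deterministic flow *)

Lemma slope_cvg_continuous (R : realType) (D : set R) (f : R -> R) (c l : R) :
  (s - c)^-1 * (f s - f c) @[s --> within D c^'] --> l ->
  f s @[s --> within D (nbhs c)] --> f c.
Proof.
move=> fl.
have sc0 : s - c @[s --> within D c^'] --> (0 : R).
  rewrite -(subrr c); apply: cvgB; last exact: cvg_cst.
  exact: (cvg_trans (cvg_within _) (cvg_within _)).
have prod0 : (s - c) * ((s - c)^-1 * (f s - f c)) @[s --> within D c^']
    --> (0 : R).
  by rewrite -(mul0r l); apply: cvgM.
apply/cvgrPdist_lt => e e0.
have /cvgrPdist_lt/(_ e e0) := prod0.
rewrite !near_withinE. apply: filterS => s hs Ds.
have [->|sc] := eqVneq s c; first by rewrite subrr normr0.
move: (hs sc Ds); rewrite sub0r normrN mulrA divff ?subr_eq0// mul1r.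
by rewrite distrC.
Qed.

(** Passes from the relative difference quotient of [ode_solution] to an ordinary derivative at
    interior times. *)
Lemma slope_cvg_derive (R : realType) (D : set R) (f : R -> R) (c l : R) :
  nbhs c D -> (s - c)^-1 * (f s - f c) @[s --> within D c^'] --> l ->
  is_derive c 1 f l.
Proof.
move=> Dc fl.
have dl : h^-1 *: (f (h *: 1 + c) - f c) @[h --> 0^'] --> l.
  apply/cvgrPdist_lt => e e0; have /cvgrPdist_lt/(_ e e0) := fl.
  rewrite near_withinE /dnbhs near_withinE => near_c.
  have {near_c} : \forall s \near c, s != c ->
      `|l - (s - c)^-1 * (f s - f c)| < e.
    by apply: filterS2 Dc near_c => s Ds h sc; exact: h.
  move=> /nbhs_ballP[d /= d0 hd].
  rewrite near_withinE; apply/nbhs_ballP; exists d => //= h.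
  rewrite /ball/= sub0r normrN => hlt h0.
  have := hd (h + c); rewrite /ball/= opprD addrCA subrr addr0 normrN addrK.
  rewrite -subr_eq0 addrK => /(_ hlt h0).
  by rewrite /GRing.scale/= mulr1.
by apply: DeriveDef; [apply: cvgP dl | apply: cvg_lim dl].
Qed.

(** The fundamental theorem of calculus asks for derivatives on the open interval and continuity at
    its ends; the one-sided quotient at 0 supplies the continuity there. *)
Lemma slope_cvg_FTC (R : realType) (f g : R -> R) (t : R) :
  0 <= t -> (forall c, 0 <= c ->
    (s - c)^-1 * (f s - f c) @[s --> within `[0, +oo[ c^'] --> g c) ->
  {within `[0, t], continuous g} ->
  f t = f 0 + \int[lebesgue_measure]_(u in `[0, t]) g u.
Proof.
rewrite le_eqVlt => /predU1P[<- _ _|t0 fg cg].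
  by rewrite set_itv1 Rintegral_set1 addr0.
have cf : {within `[0, t], continuous f}.
  apply/subspace_continuousP => c; rewrite /= in_itv/= => /andP[c0 ct].
  apply: cvg_trans (slope_cvg_continuous (fg c c0)); apply: cvg_app.
  by apply: within_subset => z/=; rewrite !in_itv/= => /andP[->].
have df c : c \in `]0, t[ -> is_derive c 1 f (g c).
  rewrite in_itv/= => /andP[c0 ct].
  apply: (@slope_cvg_derive _ `[0, +oo[%classic); last by apply: fg; exact: ltW.
  have : c \in `]0, t[ by rewrite in_itv/= c0.
  move=> /near_in_itvoo; apply: filterS => z.
  by rewrite in_itv/= => /andP[z0 _]; rewrite in_itv/= ltW.
rewrite /Rintegral (@continuous_FTC2 _ g f)//.
- by rewrite -EFinB/=; ring.
- have /(continuous_within_itvP _ t0)[_ f0 ft] := cf.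
  by split=> // c /df[].
- by move=> c /df h; rewrite derive1E; exact: derive_val.
Qed.

Section ode.
Context {R : realType} {N : nat}.
Variables (nu : R) (x : 'rV[R]_N) (phi : R -> 'rV[R]_N).
Hypothesis phi_ode : ode_solution (driftB nu 1) x phi.
Hypothesis phi_int : forall t, 0 <= t -> open_chamber (phi t).

Lemma ode_coord_continuous (t : R) i :
  {within `[0, t], continuous (fun s => phi s 0 i)}.
Proof.
apply/subspace_continuousP => c; rewrite /= in_itv/= => /andP[c0 ct].
apply: cvg_trans (slope_cvg_continuous (phi_ode.2 c c0 i)); apply: cvg_app.
by apply: within_subset => z/=; rewrite !in_itv/= => /andP[->].
Qed.

Lemma ode_diff_neq0 s i j : 0 <= s -> j != i -> phi s 0 i - phi s 0 j != 0.
Proof.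
move=> /phi_int [decr _] ji; rewrite subr_eq0.
move: ji; rewrite -val_eqE /= neq_ltn => /orP[] /decr h.
  by rewrite lt_eqF.
by rewrite gt_eqF.
Qed.

Lemma ode_sum_gt0 s i j : 0 <= s -> 0 < phi s 0 i + phi s 0 j.
Proof. by move=> /phi_int [_ pos]; exact: addr_gt0. Qed.

Lemma ode_drift_continuous (t : R) i :
  {within `[0, t], continuous (fun s => driftB nu 1 (phi s) 0 i)}.
Proof.
apply/subspace_continuousP => c ct.
have c0 : 0 <= c by move: ct; rewrite /= in_itv/= => /andP[].
have cphi k : phi s 0 k @[s --> within `[0, t]%classic (nbhs c)] --> phi c 0 k.
  by have /subspace_continuousP/(_ c ct) := @ode_coord_continuous t k.
rewrite /from_subspace; under eq_fun do rewrite mxE.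
rewrite mxE; apply: cvgD.
  apply: cvgM; first exact: cvg_cst.
  apply: cvg_sum => j ji; apply: cvgD.
    by apply: cvgV; [exact: ode_diff_neq0 | exact: cvgB].
  by apply: cvgV; [rewrite gt_eqF// ode_sum_gt0 | exact: cvgD].
apply: cvgM; first exact: cvg_cst.
by apply: cvgV; [case: (phi_int c0) => _ /(_ i)/gt_eqF -> | exact: cphi].
Qed.

(** Puts [phi] in the same integral form as the paths of [X] and [W], so that the three can be
    subtracted. *)
Lemma ode_integral (t : R) i : 0 <= t ->
  lebesgue_measure.-integrable `[0, t] (fun s => (driftB nu 1 (phi s) 0 i)%:E)
  /\ phi t 0 i = x 0 i +
    \int[lebesgue_measure]_(s in `[0, t]) driftB nu 1 (phi s) 0 i.
Proof.
move=> t0; split.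
  apply: continuous_compact_integrable; first exact: segment_compact.
  exact: ode_drift_continuous.
rewrite -phi_ode.1; apply: (slope_cvg_FTC (f := fun s => phi s 0 i)) => //.
- by move=> c c0; exact: phi_ode.2.
- exact: ode_drift_continuous.
Qed.

End ode.

(** * Uniform bounds on a compact time interval *)

Lemma within_itv_lower_bound (R : realType) (t : R) (f : R -> R) :
  {within `[0, t], continuous f} ->
  (forall s, 0 <= s <= t -> 0 < f s) ->
  exists2 m, 0 < m & forall s, 0 <= s <= t -> m <= f s.
Proof.
move=> cf f0; have [t0|t0] := leP 0 t; last first.
  by exists 1 => // s /andP[s0 st]; move: (le_trans s0 st); rewrite leNgt t0.
have [c] := EVT_min t0 cf; rewrite in_itv/= => ct fc.
by exists (f c); [exact: f0 | move=> s st; apply: fc; rewrite in_itv].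
Qed.

Lemma within_itv_upper_bound (R : realType) (t : R) (f : R -> R) :
  {within `[0, t], continuous f} ->
  exists2 M, 0 <= M & forall s, 0 <= s <= t -> `|f s| <= M.
Proof.
move=> cf; have [t0|t0] := leP 0 t; last first.
  by exists 0 => // s /andP[s0 st]; move: (le_trans s0 st); rewrite leNgt t0.
have cnf : {within `[0, t], continuous (fun s => `|f s|)}.
  apply/subspace_continuousP => c ct; apply: cvg_norm.
  by have /subspace_continuousP/(_ c ct) := cf.
have [c] := EVT_max t0 cnf; rewrite in_itv/= => ct fc.
by exists `|f c| => // s st; apply: fc; rewrite in_itv.
Qed.

Lemma common_lower_bound (R : realType) (I : finType) (D : set R)
    (Q : pred I) (f : I -> R -> R) :
  (forall i, Q i -> exists2 m, 0 < m & forall s, D s -> m <= f i s) ->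
  exists2 m, 0 < m & forall i s, Q i -> D s -> m <= f i s.
Proof.
move=> h.
have /choice[m hm] : forall i, exists m, Q i ->
    0 < m /\ forall s, D s -> m <= f i s.
  move=> i; case: (boolP (Q i)) => [/h[m m0 hm]|_]; first by exists m.
  by exists 1.
(* The default 1 keeps the minimum positive even if no index satisfies [Q], as for pairs of
   coordinates when N <= 1. *)
exists (\big[Order.min/1]_(i | Q i) m i).
  by apply: lt_bigmin => [|i /hm[]//]; exact: ltr01.
move=> i s Qi Ds; apply: le_trans (_ : m i <= _); last by have [_] := hm i Qi; exact.
exact: bigmin_le_cond.
Qed.

(** * Comparison of paths *)

Lemma enorm_le_sum (R : realType) (N : nat) (v : 'rV[R]_N) :
  enorm v <= \sum_i `|v 0 i|.
Proof.
have S0 : 0 <= \sum_i `|v 0 i| by apply: sumr_ge0.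
rewrite /enorm -[leRHS]ger0_norm// -sqrtr_sqr ler_wsqrtr// expr2 mulr_suml.
apply: ler_sum => i _; rewrite -real_normK ?num_real// expr2 ler_wpM2l//.
by rewrite (bigD1 i)//= lerDl sumr_ge0.
Qed.

Lemma coord_le_enorm (R : realType) (N : nat) (v : 'rV[R]_N) i :
  `|v 0 i| <= enorm v.
Proof.
rewrite -sqrtr_sqr /enorm ler_wsqrtr// (bigD1 i)//= lerDl sumr_ge0// => j _.
exact: sqr_ge0.
Qed.

Lemma within_coord_continuous (R : realType) (N : nat) (t : R)
    (z : R -> 'rV[R]_N) i :
  {within `[0, +oo[, continuous z} ->
  {within `[0, t], continuous (fun s => z s 0 i)}.
Proof.
move=> /subspace_continuousP cz; apply/subspace_continuousP => c.
rewrite /= in_itv/= => /andP[c0 ct].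
have {}cz : z s @[s --> within `[0, +oo[%classic (nbhs c)] --> z c.
  by apply: cz; rewrite /= in_itv/= c0.
have := cvg_comp _ _ cz (@coord_continuous R 1 N 0 i (z c)).
apply: cvg_trans; apply: cvg_app; apply: within_subset => s/=.
by rewrite !in_itv/= => /andP[->].
Qed.

Section comparison.
Context {R : realType} {N : nat}.
Variables (nu : R) (x y : 'rV[R]_N) (phi b w : R -> 'rV[R]_N).
Hypothesis nu_ge0 : 0 <= nu.
Hypothesis phi_ode : ode_solution (driftB nu 1) x phi.
Hypothesis phi_int : forall t, 0 <= t -> open_chamber (phi t).
Hypothesis w_sol : integral_solution (fun t => lin_driftB nu (phi t)) y b w.

(** The scale [a] is kept independent of [Num.sqrt beta], so that both ranges of [beta] are covered.
    Since [w] starts at [y], the difference starts at (sqrt beta - a) x, and [b] cancels in it;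
    [energy_bound] then applies. *)
Lemma comparison_bound (beta a c t : R) (X : R -> 'rV[R]_N) :
  0 <= beta -> 0 <= c -> 0 <= t ->
  bessel_path (nu * beta) beta (Num.sqrt beta *: x + y) b X ->
  (forall s, 0 <= s <= t -> open_chamber (a *: phi s + w s)) ->
  (forall s i, 0 <= s <= t ->
    `|driftB (nu * beta) beta (a *: phi s + w s) 0 i
      - a * driftB nu 1 (phi s) 0 i - lin_driftB nu (phi s) (w s) 0 i| <= c) ->
  forall s, 0 <= s <= t ->
    enorm (X s - a *: phi s - w s) <=
      `|Num.sqrt beta - a| * enorm x + 2 * c * N%:R * t.
Proof.
move=> beta0 c0 t0 [_ X_ae [_ XE]] p_int p_le s st.
have := @energy_bound R N t c (fun i => (Num.sqrt beta - a) * x 0 i)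
  (fun i u => driftB (nu * beta) beta (X u) 0 i - a * driftB nu 1 (phi u) 0 i
    - lin_driftB nu (phi u) (w u) 0 i)
  (fun i u => (X u - a *: phi u - w u) 0 i) t0 c0 _ _ _ s st.
have -> : Num.sqrt (\sum_i ((Num.sqrt beta - a) * x 0 i) ^+ 2) =
    `|Num.sqrt beta - a| * enorm x.
  under eq_bigr do rewrite exprMn.
  by rewrite -mulr_sumr sqrtrM ?sqr_ge0// sqrtr_sqr.
have mD u : measurable (`[0, u]%classic : set (measurableTypeR R)) by [].
have i1 u i : 0 <= u -> lebesgue_measure.-integrable `[0, u]
    (EFin \o (fun r => driftB (nu * beta) beta (X r) 0 i)).
  by move=> u0; have [] := XE u i u0.
have i2 u i : 0 <= u -> lebesgue_measure.-integrable `[0, u]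
    (EFin \o (fun r => driftB nu 1 (phi r) 0 i)).
  by move=> u0; have [] := ode_integral phi_ode phi_int i u0.
have i2' u i : 0 <= u -> lebesgue_measure.-integrable `[0, u]
    (EFin \o (fun r => a * driftB nu 1 (phi r) 0 i)).
  by move=> u0; exact: integrableZl (i2 u i u0).
have i3 u i : 0 <= u -> lebesgue_measure.-integrable `[0, u]
    (EFin \o (fun r => lin_driftB nu (phi r) (w r) 0 i)).
  by move=> u0; have [] := w_sol.2 u i u0.
have i12 u i : 0 <= u -> lebesgue_measure.-integrable `[0, u]
    (EFin \o (fun r => driftB (nu * beta) beta (X r) 0 i -
                       a * driftB nu 1 (phi r) 0 i)).
  by move=> u0; exact: (integrableB (mD u) (i1 u i u0) (i2' u i u0)).
apply.
- by move=> i; exact: (integrableB (mD t) (i12 t i t0) (i3 t i t0)).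
- move=> i u /andP[u0 _]; rewrite RintegralB ?RintegralB ?RintegralZl//;
    [|exact: i2|exact: i1|exact: i2'|exact: i12|exact: i3].
  rewrite !mxE (XE u i u0).2 (ode_integral phi_ode phi_int i u0).2.
  by rewrite (w_sol.2 u i u0).2 !mxE; ring.
(* Monotonicity is available only while [X u] is in the open chamber, that is for almost every [u].
   It disposes of the difference of the two [beta]-drifts; the linearization error [r] costs at most
   [c] per unit of each coordinate. *)
- apply: filterS X_ae => u Xu u0t; have /andP[u0 _] := u0t.
  have /weylB_interior Xu' := Xu u0.
  have := driftB_monotone (mulr_ge0 nu_ge0 beta0) beta0 Xu' (p_int u u0t).
  rewrite mulr_sumr -(lerD2l (\sum_i c * `|(X u - a *: phi u - w u) 0 i|)).
  rewrite addr0; apply: le_trans; rewrite -big_split/=.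
  apply: ler_sum => i _.
  have := p_le u i u0t; set Fp := driftB _ _ (_ + _) 0 i.
  set r := _ - _ => rc.
  have zr : (X u - a *: phi u - w u) 0 i * r <= c * `|(X u - a *: phi u - w u) 0 i|.
    rewrite mulrC; apply: le_trans (ler_norm _) _.
    by rewrite normrM ler_wpM2r.
  by move: zr; rewrite /r !mxE; lra.
Qed.

(** Two regimes, separated by a threshold [a0]: compare at scale a = sqrt beta above it, and at the
    fixed scale a = [a0] below it. *)
Lemma path_bound (beta0 t : R) (X : R -> R -> 'rV[R]_N) : 0 < beta0 -> 0 <= t ->
  (forall beta, beta0 <= beta -> bessel_path (nu * beta) beta
     (Num.sqrt beta *: x + y) b (X beta)) ->
  exists C, forall beta s, beta0 <= beta -> 0 <= s <= t ->
    Num.sqrt beta * enorm (X beta s - Num.sqrt beta *: phi s - w s) <= C.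
Proof.
move=> beta00 t0 X_sol.
have cphi i : {within `[0, t], continuous (fun s => phi s 0 i)}.
  exact: ode_coord_continuous phi_ode _ _.
have [m1 m10 hm1] : exists2 m, 0 < m & forall (ij : 'I_N * 'I_N) s,
    (ij.1 < ij.2)%N -> 0 <= s <= t -> m <= phi s 0 ij.1 - phi s 0 ij.2.
  apply: (@common_lower_bound R ('I_N * 'I_N)%type (fun s => 0 <= s <= t)
    (fun ij => (ij.1 < ij.2)%N) (fun ij s => phi s 0 ij.1 - phi s 0 ij.2)).
  move=> [i j] /= ij.
  apply: within_itv_lower_bound => [|s /andP[/phi_int[decr _] _]]; last first.
    by rewrite subr_gt0 decr.
  apply/subspace_continuousP => c ct; apply: cvgB.
    by have /subspace_continuousP/(_ c ct) := cphi i.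
  by have /subspace_continuousP/(_ c ct) := cphi j.
have [m2 m20 hm2] : exists2 m, 0 < m & forall (i : 'I_N) s,
    true -> 0 <= s <= t -> m <= phi s 0 i.
  apply: (@common_lower_bound R _ (fun s => 0 <= s <= t) xpredT
    (fun i s => phi s 0 i)) => i _.
  by apply: within_itv_lower_bound => // s /andP[/phi_int[_ pos] _].
have [Mphi hMphi] : exists Mphi : R, forall i s, 0 <= s <= t -> `|phi s 0 i| <= Mphi.
  have /choice[M hM] : forall i, exists M, forall s, 0 <= s <= t ->
      `|phi s 0 i| <= M.
    by move=> i; have [M _ hM] := within_itv_upper_bound (cphi i); exists M.
  exists (\sum_i `|M i|) => i s st; apply: le_trans (hM i s st) _.
  by apply: le_trans (ler_norm _) _; rewrite (bigD1 i)//= lerDl sumr_ge0.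
have [Mw hMw] : exists Mw : R, forall i s, 0 <= s <= t -> `|w s 0 i| <= Mw.
  have /choice[M hM] : forall i, exists M, forall s, 0 <= s <= t ->
      `|w s 0 i| <= M.
    move=> i; have [M _ hM] :=
      within_itv_upper_bound (within_coord_continuous (t := t) (i := i) w_sol.1).
    by exists M.
  exists (\sum_i `|M i|) => i s st; apply: le_trans (hM i s st) _.
  by apply: le_trans (ler_norm _) _; rewrite (bigD1 i)//= lerDl sumr_ge0.
pose m := Num.min m1 m2.
have m0 : 0 < m by rewrite lt_min m10.
(* The factor 2 bounds the sums and differences of two coordinates of [w]. *)
pose M := 2 * `|Mw|; have M0 : 0 <= M by rewrite mulr_ge0.
have phi_diff s (i j : 'I_N) : 0 <= s <= t -> (i < j)%N -> m <= phi s 0 i - phi s 0 j.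
  by move=> st ij; rewrite ge_min (hm1 (i, j)).
have phi_pos s i : 0 <= s <= t -> m <= phi s 0 i.
  by move=> st; rewrite ge_min (hm2 i) ?orbT.
have w_le s i : 0 <= s <= t -> `|w s 0 i| <= M / 2.
  by move=> st; rewrite /M mulrC mulKf//; apply: le_trans (hMw i s st) (ler_norm _).
(* The smallest scale from which both hypotheses [a1] and [aM] of the root bounds hold. *)
pose a0 := Num.max 1 (2 * M / m).
have a0m a : a0 <= a -> 1 <= a /\ 2 * M <= a * m.
  by rewrite ge_max ler_pdivrMr// => /andP[].
have p_int a s : a0 <= a -> 0 <= s <= t -> open_chamber (a *: phi s + w s).
  move=> /a0m[a1 aM] st.
  have am : 0 < a * m by rewrite mulr_gt0// (lt_le_trans ltr01).
  have big u : m <= u -> a * m <= a * u.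
    by move=> mu; rewrite ler_wpM2l// (le_trans ler01).
  split=> [i j ij|i]; rewrite !mxE.
    have := big _ (phi_diff s i j st ij).
    have := w_le s i st; have := w_le s j st; rewrite !ler_norml; lra.
  have := big _ (phi_pos s i st).
  have := w_le s i st; rewrite !ler_norml; lra.
have dist_le s (i j : 'I_N) : 0 <= s <= t -> j != i -> m <= `|phi s 0 i - phi s 0 j|.
  move=> st; rewrite -val_eqE /= neq_ltn => /orP[] ij.
    by rewrite distrC; apply: le_trans (phi_diff s j i st ij) (ler_norm _).
  by apply: le_trans (phi_diff s i j st ij) (ler_norm _).
have sum_le s i j : 0 <= s <= t -> m <= `|phi s 0 i + phi s 0 j|.
  move=> st; apply: le_trans (ler_norm _).
  by have := phi_pos s i st; have := phi_pos s j st; lra.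
have one_le s i : 0 <= s <= t -> m <= `|phi s 0 i|.
  by move=> st; apply: le_trans (phi_pos s i st) (ler_norm _).
have wD s i j : 0 <= s <= t -> `|w s 0 i - w s 0 j| <= M.
  move=> st; apply: le_trans (ler_normB _ _) _.
  by have := w_le s i st; have := w_le s j st; lra.
have wS s i j : 0 <= s <= t -> `|w s 0 i + w s 0 j| <= M.
  move=> st; apply: le_trans (ler_normD _ _) _.
  by have := w_le s i st; have := w_le s j st; lra.
have w1 s i : 0 <= s <= t -> `|w s 0 i| <= M.
  by move=> st; have := w_le s i st; lra.
have lin_le beta a r : a0 <= a -> 0 <= r ->
    (forall u v, m <= `|u| -> `|v| <= M -> `|root_remainder beta a u v| <= r) ->
    forall s i, 0 <= s <= t ->
    `|driftB (nu * beta) beta (a *: phi s + w s) 0 i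
      - a * driftB nu 1 (phi s) 0 i - lin_driftB nu (phi s) (w s) 0 i| <=
    (2 * N%:R + nu) * r.
  move=> aa0 r0 rr s i st; apply: driftB_linearization_le => // [j ji|j|].
  - by apply: rr; [exact: dist_le | exact: wD].
  - by apply: rr; [exact: sum_le | exact: wS].
  - by apply: rr; [exact: one_le | exact: w1].
pose k := 2 * N%:R + nu; have k0 : 0 <= k by rewrite addr_ge0.
pose c1 := 2 * M ^+ 2 / m ^+ 3.
have c10 : 0 <= c1 by rewrite divr_ge0 ?mulr_ge0 ?exprn_ge0// ltW.
pose c2 := 3 * a0 / m + M / m ^+ 2.
have a01 : 1 <= a0 by rewrite le_max lexx.
have c20 : 0 <= c2.
  by rewrite addr_ge0// divr_ge0 ?mulr_ge0 ?exprn_ge0 ?(ltW m0)// (le_trans ler01).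
pose C1 := 2 * (k * c1) * N%:R * t.
(* [Q] bounds the distance of [X] to [a0 *: phi + w] in the low regime. Going back to the scale sqrt
   beta costs at most [a0 * Mphi] in each of the [N] coordinates, and the outer factor sqrt beta is
   below [a0]; hence [C2]. *)
pose Q := a0 * enorm x + 2 * (k * c2) * N%:R * t.
pose C2 := a0 * (N%:R * Q + N%:R * (a0 * Mphi)).
exists (Num.max C1 C2) => beta s bb st.
have beta_gt0 : 0 < beta by exact: lt_le_trans bb.
have sb0 : 0 < Num.sqrt beta by rewrite sqrtr_gt0.
have sb2 : Num.sqrt beta ^+ 2 = beta by rewrite sqr_sqrtr// ltW.
rewrite le_max; have [a0b|ba0] := leP a0 (Num.sqrt beta); apply/orP.
  left; have [a1 aM] := a0m _ a0b.
  have r0 : 0 <= c1 / Num.sqrt beta by rewrite divr_ge0// ltW.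
  have := comparison_bound (ltW beta_gt0) (mulr_ge0 k0 r0) t0 (X_sol _ bb)
    (fun s => p_int _ s a0b) _ st.
  rewrite subrr normr0 mul0r add0r => H.
  rewrite mulrC -ler_pdivlMr//.
  rewrite (_ : C1 / _ = 2 * (k * (c1 / Num.sqrt beta)) * N%:R * t); last first.
    by rewrite /C1; ring.
  apply: H; apply: lin_le => // u v mu vM; rewrite -[X in root_remainder X]sb2.
  exact: root_remainder_sqr_le.
right; have [a1 aM] := a0m _ (lexx a0).
have := comparison_bound (ltW beta_gt0) (mulr_ge0 k0 c20) t0 (X_sol _ bb)
  (fun s => p_int _ s (lexx a0)) _ st.
have -> : `|Num.sqrt beta - a0| = a0 - Num.sqrt beta.
  by rewrite distrC gtr0_norm// subr_gt0.
have x0 : 0 <= enorm x by exact: sqrtr_ge0.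
move=> H; have {H} eQ : enorm (X beta s - a0 *: phi s - w s) <= Q.
  apply: le_trans (H _) _; last first.
    by rewrite lerD2r ler_wpM2r// gerBl ltW.
  apply: lin_le => // u v mu vM; apply: root_remainder_le => //.
  rewrite (ltW beta_gt0) -sb2 lerXn2r ?nnegrE ?(ltW ba0) ?(ltW sb0)//.
  exact: le_trans a1.
apply: ler_pM; rewrite ?sqrtr_ge0 ?(ltW sb0) ?(ltW ba0)//.
apply: le_trans (enorm_le_sum _) _.
apply: (@le_trans _ _ (\sum_(i < N) (Q + a0 * Mphi))); last first.
  by rewrite sumr_const card_ord -mulr_natl; lra.
apply: ler_sum => i _.
rewrite (_ : _ 0 i = (X beta s - a0 *: phi s - w s) 0 i
   + (a0 - Num.sqrt beta) * phi s 0 i); last by rewrite !mxE; ring.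
apply: le_trans (ler_normD _ _) _; apply: lerD.
  exact: le_trans (coord_le_enorm _ _) eQ.
rewrite normrM; apply: ler_pM => //; last exact: hMphi.
by rewrite gtr0_norm ?subr_gt0// gerBl ltW.
Qed.

End comparison.

(** * From the pathwise bound to the almost sure statements *)

Lemma path_uniform_cvg (R : realType) (N : nat) (t beta0 C : R)
    (X : R -> R -> 'rV[R]_N) (phi w : R -> 'rV[R]_N) :
  (forall beta s, beta0 <= beta -> 0 <= s <= t ->
    Num.sqrt beta * enorm (X beta s - Num.sqrt beta *: phi s - w s) <= C) ->
  {uniform `[0, t],
    (fun s => X beta s - Num.sqrt beta *: phi s) @[beta --> +oo] --> w}.
Proof.
move=> bound Q /uniform_nbhs[E [entE EQ]].
move: entE; rewrite -entourage_ballE => -[e /= e0 ballE].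
have C1 : 0 < `|C| + 1 by rewrite ltr_pwDr.
near=> beta; apply: EQ => s; rewrite /= in_itv/= => st; apply: ballE => /=.
have bb : beta0 <= beta by near: beta; apply: nbhs_pinfty_ge; exact: num_real.
(* Ensures [C < Num.sqrt beta * e]; the [+ 1] makes this strict. *)
have big : ((`|C| + 1) / e) ^+ 2 < beta by near: beta; apply: nbhs_pinfty_gt; exact: num_real.
have beta_gt0 : 0 < beta by apply: le_lt_trans big; exact: sqr_ge0.
have sb0 : 0 < Num.sqrt beta by rewrite sqrtr_gt0.
have sbe : (`|C| + 1) / e < Num.sqrt beta.
  have q0 : 0 <= (`|C| + 1) / e by apply: divr_ge0; exact: ltW.
  by rewrite -(ltr_pXn2r (n := 2))// ?sqr_sqrtr ?nnegrE ?(ltW beta_gt0)// ltW.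
(* Balls of row vectors are taken coordinatewise, and each coordinate is dominated by [enorm]. *)
split=> // i j; rewrite /ball/= (ord1 i) distrC.
have -> : (X beta s - Num.sqrt beta *: phi s) 0 j - w s 0 j =
    (X beta s - Num.sqrt beta *: phi s - w s) 0 j by rewrite !mxE.
apply: le_lt_trans (coord_le_enorm _ _) _.
rewrite -(ltr_pM2l sb0); apply: le_lt_trans (bound _ _ bb st) _.
move: sbe; rewrite ltr_pdivrMr//; apply: lt_trans.
by apply: le_lt_trans (ler_norm _) _; rewrite ltrDl.
Unshelve. all: by end_near. Qed.

Theorem theorem3p2 (R : realType) (d : measure_display)
  (T : measurableType d) (P : probability T R)
  (N : nat) (nu : R) (x y : 'rV[R]_N) (beta0 : R)
  (B : R -> T -> 'rV[R]_N) (X : R -> R -> T -> 'rV[R]_N)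
  (phi : R -> 'rV[R]_N) (W : R -> T -> 'rV[R]_N)
  (nu_gt0 : 0 < nu)
  (x_int : weylB° x)
  (beta0_ge : 2^-1 <= beta0)
  (start_int : forall beta, beta0 <= beta -> weylB° (Num.sqrt beta *: x + y))
  (B_bm : brownian_motion P B)
  (X_bessel :
    bessel_family P nu beta0 (fun beta => Num.sqrt beta *: x + y) B X)
  (phi_ode : ode_solution (driftB nu 1) x phi)
  (phi_int : forall t : R, 0 <= t -> weylB° (phi t))
  (W_sol : strong_solution P (fun t => lin_driftB nu (phi t)) y B W) :
  (forall t : R, 0 < t ->
    {ae P, forall w,
      (ereal_sup [set (Num.sqrt beta *
                       enorm (X beta s w - Num.sqrt beta *: phi s - W s w))%R%:E
                 | s in `[0%R, t]%classic & beta in `[beta0, +oo[%classic]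
         < +oo)%E}) /\
  {ae P, forall w, forall t : R, 0 < t ->
    {uniform `[0, t],
      (fun s => X beta s w - Num.sqrt beta *: phi s) @[beta --> +oo]
      --> (W ^~ w)}}.
Proof.
have beta00 : 0 < beta0 by apply: lt_le_trans beta0_ge; rewrite invr_gt0.
have phi_chamber t : 0 <= t -> open_chamber (phi t).
  by move=> /phi_int/weylB_interior.
(* The quantifier over [t] lies inside the event: one null set serves all times and all [beta], as
   the uniform convergence requires. *)
have bound : {ae P, forall w, forall t, 0 < t -> exists C, forall beta s,
    beta0 <= beta -> 0 <= s <= t -> Num.sqrt beta *
      enorm (X beta s w - Num.sqrt beta *: phi s - W s w) <= C}.
  apply: filterS2 X_bessel.2 W_sol.2 => w Xw Ww t t0.
  exact: (path_bound (ltW nu_gt0) phi_ode phi_chamber Ww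
    (X := fun beta s => X beta s w) beta00 (ltW t0) Xw).
split=> [t t0|].
  apply: filterS bound => w /(_ t t0)[C hC].
  apply: (@le_lt_trans _ _ C%:E); last exact: ltry.
  apply: ge_ereal_sup => _ [s /= st [beta /= bb <-]].
  rewrite lee_fin; apply: hC.
    by move: bb; rewrite in_itv/= andbT.
  by move: st; rewrite in_itv.
apply: filterS bound => w bw t /bw[C hC].
exact: (path_uniform_cvg (X := fun beta s => X beta s w) hC).
Qed.
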